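(* Let $\mathcal A$ be an algebra of subsets of a set $\Omega$ and let $1<p<\infty$. Suppose that $\phi:\mathcal A\to\mathbb R$ is a normalized submeasure which satisfies a lower $p$-estimate. Then there is a measure $\lambda$ on $\mathcal A$ with $0\le\lambda(A)\le\phi(A)$ for all $A\in\mathcal A$ and $\lambda(\Omega)\ge K_p$, where $K_p=\dfrac{2}{(2^p-1)^{1/p}}-1$.
   Context: A set-function $\phi:\mathcal A\to\mathbb R$ is monotone if $\phi(\emptyset)=0$ and $\phi(A)\le\phi(B)$ whenever $A\subset B$, $A,B\in\mathcal A$. It is normalized if $\phi(\Omega)=1$. A monotone set-function $\phi$ is a submeasure if $\phi(A\cup B)\le\phi(A)+\phi(B)$ for all disjoint $A,B\in\mathcal A$, and a supermeasure if $\phi(A\cup B)\ge\phi(A)+\phi(B)$ for all disjoint $A,B\in\mathcal A$. A measure on $\mathcal A$ means a monotone set-function that is both a submeasure and a supermeasure (i.e. a nonnegative, finitely additive set-function). A monotone set-function $\phi$ satisfies a lower $p$-estimate if $\phi^p$ is a supermeasure. *)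

(* Defs.v *)
From mathcomp Require Import all_boot all_order all_algebra.
From mathcomp Require Import boolp classical_sets reals exp measure.

Set Implicit Arguments.
Unset Strict Implicit.
Unset Printing Implicit Defensive.

Import Order.TTheory GRing.Theory Num.Theory.

Local Open Scope classical_set_scope.
Local Open Scope ring_scope.

Definition algebra_of_sets (T : Type) (A : set (set T)) : Prop :=
  [/\ A set0, setC_closed A & setU_closed A].

(* A set-function on an algebra A is a total function [set T -> R] whose values
   outside A are irrelevant: every notion below only looks at members of A. *)

Definition monotone_setfun (T : Type) (R : realType) (A : set (set T))
    (phi : set T -> R) : Prop :=
  phi set0 = 0 /\
  (forall X Y : set T, A X -> A Y -> X `<=` Y -> phi X <= phi Y).

Definition normalized (T : Type) (R : realType) (phi : set T -> R) : Prop :=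
  phi setT = 1.

Definition submeasure (T : Type) (R : realType) (A : set (set T))
    (phi : set T -> R) : Prop :=
  monotone_setfun A phi /\
  (forall X Y : set T, A X -> A Y -> X `&` Y = set0 ->
    phi (X `|` Y) <= phi X + phi Y).

Definition supermeasure (T : Type) (R : realType) (A : set (set T))
    (phi : set T -> R) : Prop :=
  monotone_setfun A phi /\
  (forall X Y : set T, A X -> A Y -> X `&` Y = set0 ->
    phi X + phi Y <= phi (X `|` Y)).

(* Finitely additive, unlike the library's (countably additive) [measure]. *)
Definition fa_measure (T : Type) (R : realType) (A : set (set T))
    (lam : set T -> R) : Prop :=
  submeasure A lam /\ supermeasure A lam.

Definition lower_estimate (T : Type) (R : realType) (A : set (set T)) (p : R)
    (phi : set T -> R) : Prop :=
  monotone_setfun A phi /\ supermeasure A (fun X => phi X `^ p).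

Definition K (R : realType) (p : R) : R :=
  2 / (2 `^ p - 1) `^ p^-1 - 1.

(* Main.v *)
Require Import Defs.
From mathcomp Require Import all_boot all_order all_algebra.
From mathcomp Require Import boolp classical_sets reals exp measure.
From mathcomp Require Import interval_inference filter topology normedtype.
From mathcomp Require Import sequences hoelder.
From mathcomp Require Import ring lra.

(** Put [rho = (1 - 2^-p)^(1/p)], so that [K p = (1 - rho) / rho]. Suppose first
that the algebra consists of all subsets of a finite type. Measures are then
given by weights, and [kappa Z], the largest mass that a measure below [phi]
can give to [Z], is a maximum ([exists_optimal]). Two facts drive the proof.

- The set function [kappa] inherits the lower [p]-estimate
  ([dominated_mass_lower]): a measure on [X] and a measure on a disjoint set
  [Z], both below [phi], can be scaled so that their sum is below [phi] and its
  mass is the [l^p]-norm of the two masses.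
- If [c * m <= phi] on the subsets of [Z] for a measure [m], then
  [c * m Z <= kappa Z]. So when [c * m Z > kappa Z], some subset [X] of [Z] is
  cheap, that is [phi X < c * m X].

Choose [Y] minimizing the ratio [g = kappa Y / phi Y], and let [w] be optimal on
[Y]; suppose [g < (1 - rho) / rho]. Fix [c > 2 * rho] with
[c * g < 2 * (1 - rho)], and let [B] be a largest subset of [Y] which is cheap:
[phi B <= c * w B]. With [y = w B / kappa Y], the first fact bounds
[kappa (Y \ B)] by [(1 - y^p)^(1/p) * kappa Y].

If [y < 1/2], this bound is at most [2 * rho * (1 - y) * kappa Y], hence smaller
than [c * w (Y \ B)], and by the second fact some cheap subset of [Y \ B] can be
added to [B], against maximality. If [y >= 1/2], subadditivity gives
[phi (Y \ B) >= (1 - c * g * y) * phi Y]; the minimality of [g] turns this into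
[kappa (Y \ B) >= (1 - c * g * y) * kappa Y], which contradicts the bound, since
[(1 - y^p)^(1/p) <= 1 - 2 * (1 - rho) * y] for [y >= 1/2]. The two estimates of
[(1 - y^p)^(1/p)] are instances of the convexity of [x^p], with equality at
[y = 1/2]. Hence [g >= K p], and in particular the whole space carries a measure
of mass at least [K p * phi setT] ([finite_bound]).

In general, finitely many members of the algebra generate a finite algebra, to
which the finite case applies; realizing the weights by point masses gives a
measure on all subsets that is below [phi] on those members
([discrete_measure_below]). An ultrafilter limit of these measures along the
directed family of finite lists of members is the desired measure. *)

Set Implicit Arguments.
Unset Strict Implicit.
Unset Printing Implicit Defensive.

Import Order.TTheory GRing.Theory Num.Theory.
Import numFieldNormedType.Exports.

Local Open Scope classical_set_scope.
Local Open Scope ring_scope.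

(** * Convexity of powers *)

Lemma powR_convex_comb (R : realType) (p t x z : R) :
  1 <= p -> 0 <= t <= 1 -> 0 <= x -> 0 <= z ->
  (t * x + (1 - t) * z) `^ p <= t * x `^ p + (1 - t) * z `^ p.
Proof.
move=> p1 /andP[t0 t1] x0 z0.
by apply: (convex_powR p1 (Itv01 t0 t1)); rewrite ?inE/= ?in_itv/= ?andbT.
Qed.

(** The right side is a convex function of [y] equal to [1] at [1/2] and at [1],
and [1/2] lies between [y] and [1]. The parameter [t] is the coefficient of [y]
in the convex combination that gives [1/2]. *)
Lemma powR_sum_ge1_left (R : realType) (p rho y : R) :
  1 <= p -> 0 <= rho -> 2^-1 `^ p + rho `^ p = 1 -> 0 <= y <= 2^-1 ->
  1 <= y `^ p + (2 * rho * (1 - y)) `^ p.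
Proof.
move=> p1 rho0 rhoE /andP[y0 y2].
have p0 : p != 0 by rewrite gt_eqF// (lt_le_trans _ p1).
pose t := (2 * (1 - y))^-1.
have t0 : 0 < t by rewrite invr_gt0; lra.
have tE : t * (2 * (1 - y)) = 1 by rewrite mulVf// gt_eqF//; lra.
have t01 : 0 <= t <= 1 by rewrite ltW//= invf_le1; lra.
have h1 := powR_convex_comb p1 t01 y0 ler01.
have -> : y `^ p = t^-1 * (t * y `^ p) by rewrite mulKf// gt_eqF.
have z0 : 0 <= 2 * rho * (1 - y) by rewrite !mulr_ge0//; lra.
have h2 := powR_convex_comb p1 t01 z0 (lexx 0).
move: h1 h2; rewrite mulr0 addr0 powR0// mulr0 addr0 powR1 !mulr1.
have -> : t * y + (1 - t) = 2^-1 by nra.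
have -> : t * (2 * rho * (1 - y)) = rho by nra.
move=> h1 h2; rewrite mulKf ?gt_eqF//.
rewrite -(@ler_pM2l _ t)//; nra.
Qed.

(** The right side is a convex function of [y] equal to [1] at [0] and at [1/2],
and [1/2] lies between [0] and [y]; here [t] is the coefficient of [y]. *)
Lemma powR_sum_ge1_right (R : realType) (p rho y : R) :
  1 <= p -> 2^-1 <= rho <= 1 -> 2^-1 `^ p + rho `^ p = 1 -> 2^-1 <= y <= 1 ->
  1 <= y `^ p + (1 - 2 * (1 - rho) * y) `^ p.
Proof.
move=> p1 /andP[rho2 rho1] rhoE /andP[y2 y1].
have p0 : p != 0 by rewrite gt_eqF// (lt_le_trans _ p1).
have y0 : 0 <= y by lra.
pose t := (2 * y)^-1.
have t0 : 0 < t by rewrite invr_gt0; lra.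
have tE : t * (2 * y) = 1 by rewrite mulVf// gt_eqF//; lra.
have t01 : 0 <= t <= 1 by rewrite ltW//= invf_le1; lra.
have z0 : 0 <= 1 - 2 * (1 - rho) * y by nra.
have h1 := powR_convex_comb p1 t01 y0 (lexx 0).
have h2 := powR_convex_comb p1 t01 z0 ler01.
move: h1 h2; rewrite mulr0 addr0 powR0// mulr0 addr0 powR1 !mulr1.
have -> : t * y = 2^-1 by nra.
have -> : t * (1 - 2 * (1 - rho) * y) + (1 - t) = rho by nra.
move=> h1 h2; rewrite -(@ler_pM2l _ t)//; nra.
Qed.

(** * Measures below a set function on a finite type *)

Definition mass (R : realType) (I : finType) (w : I -> R) (A : {set I}) : R :=
  \sum_(i in A) w i.

Definition dominated (R : realType) (I : finType) (phi : {set I} -> R)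
    (w : I -> R) : Prop :=
  (forall i, 0 <= w i) /\ (forall A, mass w A <= phi A).

Record lower_submeasure (R : realType) (I : finType) (p : R)
    (phi : {set I} -> R) : Prop := LowerSubmeasure {
  lsm0 : phi finset.set0 = 0;
  lsm_mono : forall A B : {set I}, A \subset B -> phi A <= phi B;
  lsm_sub : forall A B : {set I},
    A :&: B = finset.set0 -> phi (A :|: B) <= phi A + phi B;
  lsm_lower : forall A B : {set I}, A :&: B = finset.set0 ->
    phi A `^ p + phi B `^ p <= phi (A :|: B) `^ p }.

Lemma mass0 (R : realType) (I : finType) (w : I -> R) :
  mass w finset.set0 = 0.
Proof. by rewrite /mass big_set0. Qed.

Lemma massU (R : realType) (I : finType) (w : I -> R) (A B : {set I}) :
  A :&: B = finset.set0 -> mass w (A :|: B) = mass w A + mass w B.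
Proof.
move=> /eqP; rewrite finset.setI_eq0 => AB; rewrite /mass -bigU//=.
by apply: eq_bigl => i; rewrite !inE.
Qed.

Lemma massD (R : realType) (I : finType) (w : I -> R) (A B : {set I}) :
  B \subset A -> mass w (A :\: B) = mass w A - mass w B.
Proof.
move=> BA; rewrite /mass [in RHS](big_setID B)/= (finset.setIidPr BA).
by rewrite addrAC subrr add0r.
Qed.

Lemma mass_ge0 (R : realType) (I : finType) (w : I -> R) (A : {set I}) :
  (forall i, 0 <= w i) -> 0 <= mass w A.
Proof. by move=> w0; apply: sumr_ge0. Qed.

Lemma le_mass (R : realType) (I : finType) (w : I -> R) (A B : {set I}) :
  (forall i, 0 <= w i) -> A \subset B -> mass w A <= mass w B.
Proof. by move=> w0 AB; rewrite -subr_ge0 -massD// mass_ge0. Qed.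

Lemma mass_glue (R : realType) (I : finType) (w mu : I -> R) (X Z A : {set I})
    (a b : R) : X :&: Z = finset.set0 ->
  mass (fun i => if i \in X then a * w i else if i \in Z then b * mu i else 0) A
  = a * mass w (A :&: X) + b * mass mu (A :&: Z).
Proof.
move=> XZ; rewrite /mass (big_setID X)/= !mulr_sumr; congr (_ + _).
  by apply: eq_bigr => i /[!inE] /andP[_ ->].
rewrite (big_setID Z)/= [X in _ + X]big1 ?addr0; last first.
  by move=> i /[!inE] /and3P[/negPf-> /negPf-> _].
have -> : (A :\: X) :&: Z = A :&: Z.
  apply/setP => i; rewrite !inE; have /setP/(_ i) := XZ; rewrite !inE.
  by case: (i \in X) => //= ->; rewrite andbF.
by apply: eq_bigr => i /[!inE] /andP[_ iZ]; have /setP/(_ i) := XZ;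
  rewrite !inE iZ andbT => ->.
Qed.

(** The lower [p]-estimate passes from [phi] to the maximal mass of the measures
below it. With [a] and [b] the two masses and [N] the [l^p]-norm of [(a, b)],
the measure [s * N / a] times [w] on [X] plus [(1 - s) * N / b] times [mu] on
[Z], where [s = (a / N)^p], has total mass [N]. It is below [phi] because
convexity bounds the [p]-th power of its value on [A] by
[w (A :&: X)^p + mu (A :&: Z)^p], and the lower estimate of [phi] bounds this by
[phi A ^ p]. *)
Lemma dominated_mass_lower (R : realType) (I : finType) (p : R)
    (phi : {set I} -> R) (w mu : I -> R) (X Z : {set I}) :
  1 <= p -> lower_submeasure p phi -> dominated phi w -> dominated phi mu ->
  X :&: Z = finset.set0 ->
  exists2 nu, dominated phi nu &
    mass w X `^ p + mass mu Z `^ p <= mass nu (X :|: Z) `^ p.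
Proof.
move=> p1 Hphi [w0 wphi] [mu0 muphi] XZ.
have p0 : 0 < p by rewrite (lt_le_trans _ p1).
have pn0 : p != 0 by rewrite gt_eqF.
have a0 := mass_ge0 X w0; have b0 := mass_ge0 Z mu0.
have [aE|an0] := eqVneq (mass w X) 0.
  exists mu => //; rewrite aE powR0// add0r ge0_ler_powR ?nnegrE ?(ltW p0)//.
    exact: mass_ge0.
  by apply: le_mass => //; exact: finset.subsetUr.
have [bE|bn0] := eqVneq (mass mu Z) 0.
  exists w => //; rewrite bE powR0// addr0 ge0_ler_powR ?nnegrE ?(ltW p0)//.
    exact: mass_ge0.
  by apply: le_mass => //; exact: finset.subsetUl.
set a := mass w X in a0 an0 *; set b := mass mu Z in b0 bn0 *.
have {a0 an0} a0 : 0 < a by rewrite lt0r an0.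
have {b0 bn0} b0 : 0 < b by rewrite lt0r bn0.
have ap0 := powR_gt0 p a0; have bp0 := powR_gt0 p b0.
pose M := a `^ p + b `^ p.
have M0 : 0 < M by rewrite addr_gt0.
pose N := M `^ p^-1.
have N0 : 0 < N by rewrite powR_gt0.
have NM : N `^ p = M by rewrite /N -powRrM mulVf// powRr1// ltW.
pose s := a `^ p / M.
have s01 : 0 <= s <= 1.
  rewrite divr_ge0 ?(ltW ap0) ?(ltW M0)//= ler_pdivrMr// mul1r /M; lra.
have Mn0 : M != 0 by rewrite gt_eqF.
have sE : 1 - s = b `^ p / M by rewrite /s /M; field.
pose nu i := if i \in X then (s * N / a) * w i
             else if i \in Z then ((1 - s) * N / b) * mu i else 0.
have c0 : 0 <= s * N / a.
  by case/andP: s01 => ? ?; rewrite !mulr_ge0// ?invr_ge0 ltW.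
have d0 : 0 <= (1 - s) * N / b.
  by case/andP: s01 => ? ?; rewrite !mulr_ge0// ?subr_ge0// ?invr_ge0 ltW.
have nuE A : mass nu A =
    s * N / a * mass w (A :&: X) + (1 - s) * N / b * mass mu (A :&: Z).
  exact: mass_glue.
have nu0 i : 0 <= nu i.
  by rewrite /nu; case: ifP => _; [|case: ifP => _//]; rewrite mulr_ge0.
exists nu; last first.
  have -> : mass nu (X :|: Z) = N.
    rewrite nuE !finset.setIUl !finset.setIid XZ (finset.setIC Z X) XZ.
    rewrite finset.setU0 finset.set0U -/a -/b !divfK ?gt_eqF//.
    by rewrite -mulrDl subrKC mul1r.
  by rewrite NM.
split => // A.
rewrite nuE.
set x := mass w (A :&: X); set z := mass mu (A :&: Z).
have x0 : 0 <= x by exact: mass_ge0.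
have z0 : 0 <= z by exact: mass_ge0.
have phi0 B : 0 <= phi B.
  by rewrite -(lsm0 Hphi) (lsm_mono Hphi)// finset.sub0set.
have xphi : x <= phi (A :&: X) := wphi _.
have zphi : z <= phi (A :&: Z) := muphi _.
have AXZ : (A :&: X) :&: (A :&: Z) = finset.set0.
  by rewrite finset.setIACA XZ finset.setI0.
have AA : phi ((A :&: X) :|: (A :&: Z)) <= phi A.
  by rewrite -finset.setIUr (lsm_mono Hphi)// finset.subsetIl.
have xz : x `^ p + z `^ p <= phi A `^ p.
  apply: le_trans (_ : _ <= phi ((A :&: X) :|: (A :&: Z)) `^ p) _; last first.
    by rewrite ge0_ler_powR ?nnegrE// ltW.
  apply: le_trans (lsm_lower Hphi AXZ).
  by rewrite lerD// ge0_ler_powR ?nnegrE// ltW.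
have scale (u v : R) : 0 < u -> 0 <= v ->
    u `^ p / M * (N / u * v) `^ p = v `^ p.
  move=> u0 v0; have up := powR_gt0 p u0.
  have -> : N / u * v = v * (N / u) by rewrite mulrC.
  rewrite powRM ?divr_ge0 ?(ltW N0) ?(ltW u0)//.
  have : (N / u) `^ p * u `^ p = M.
    by rewrite -powRM ?divr_ge0 ?(ltW N0) ?(ltW u0)// divfK ?gt_eqF.
  move: ((N / u) `^ p) => q qE.
  transitivity (q * u `^ p / M * v `^ p); first by ring.
  by rewrite qE divff// mul1r.
have := @powR_convex_comb R p s (N / a * x) (N / b * z) p1 s01.
rewrite !mulr_ge0 ?invr_ge0 ?(ltW a0) ?(ltW b0) ?(ltW N0)// => /(_ isT isT).
rewrite sE /s !scale// -sE -/s => h.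
have {}h := le_trans h xz.
rewrite leNgt; apply/negP => lt.
have E : s * (N / a * x) + (1 - s) * (N / b * z)
    = s * N / a * x + (1 - s) * N / b * z by rewrite !mulrA.
suff : phi A `^ p < phi A `^ p by rewrite ltxx.
apply: lt_le_trans h; rewrite E.
apply: (gt0_ltr_powR p0 _ _ lt); rewrite nnegrE//.
exact: addr_ge0 (mulr_ge0 c0 x0) (mulr_ge0 d0 z0).
Qed.

(** * Compactness *)

(** Tychonoff's theorem for a product of segments, in terms of ultrafilters; the
limit [l] is taken along one filter [G] for all coordinates at once. *)
Lemma bounded_family_ultralimit (R : realType) (J X : Type) (F : set_system J)
    (f : J -> X -> R) (M : X -> R) : ProperFilter F ->
  (forall x, F [set j | 0 <= f j x <= M x]) ->
  exists (G : set_system J) (l : X -> R),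
    [/\ ProperFilter G, F `<=` G & forall x, f j x @[j --> G] --> l x].
Proof.
move=> FF bnd; have [G [GU FG]] := ultraFilterLemma FF.
have GF : ProperFilter G by apply: ultra_proper.
exists G; suff /choice[l lP] : forall x, exists lx : R, f j x @[j --> G] --> lx.
  by exists l.
move=> x.
have Gx : G ((fun j => f j x) @^-1` `[0, M x]).
  by apply: filterS (FG _ (bnd x)) => j /= fjx; rewrite in_itv.
have [l [_ cl]] := @segment_compact R 0 (M x) _ (fmap_proper_filter _ GF) Gx.
exists l => N Nl.
have [//|GN] := in_ultra_setVsetC ((fun j => f j x) @^-1` N) GU.
by have [y [/= NCy Ny]] := cl (~` N) N GN Nl.
Qed.

(** The weights below [phi] form a compact set. *)
Lemma exists_optimal (R : realType) (I : finType) (phi : {set I} -> R)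
    (Z : {set I}) : (forall A, 0 <= phi A) ->
  exists2 w, dominated phi w &
    forall v, dominated phi v -> mass v Z <= mass w Z.
Proof.
move=> phi0.
pose S : set R := [set m | exists2 w, dominated phi w & m = mass w Z].
have S0 : S !=set0.
  exists 0, (fun=> 0); last by rewrite /mass big1.
  by split => // A; rewrite /mass big1.
have Sub : ubound S (phi Z) by move=> _ [w [_ wphi] ->].
have Ssup : has_sup S by split => //; exists (phi Z).
have /choice[f fP] n :
    exists w, dominated phi w /\ sup S - n.+1%:R^-1 < mass w Z.
  have n0 : 0 < n.+1%:R^-1 :> R by rewrite invr_gt0.
  have [_ [w dw ->] lt] := sup_adherent n0 Ssup.
  by exists w.
have [|G [l [GF FG lP]]] :=
  @bounded_family_ultralimit R nat I \oo f (fun i => phi [set i]%SET) _.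
  move=> i; exists 0%N => // n _ /=; have [[w0 wphi] _] := fP n.
  by rewrite w0 (le_trans _ (wphi _))// /mass big_set1.
have massl A : mass (f n) A @[n --> G] --> mass l A.
  by rewrite /mass; apply: cvg_big => [|i _]; [exact: add_continuous|exact: lP].
have domG : dominated phi l.
  split=> [i|A].
    by apply: cvgr_to_ge (lP i) _; apply: nearW => n; have [[]] := fP n.
  by apply: cvgr_to_le (massl A) _; apply: nearW => n; have [[]] := fP n.
exists l => // v dv.
have vS : mass v Z <= sup S by apply: ub_le_sup; [exists (phi Z)|exists v].
apply: le_trans vS _; rewrite -subr_ge0.
have cvg0 : mass (f n) Z - (sup S - n.+1%:R^-1) @[n --> G]
    --> mass l Z - (sup S - 0).
  apply: cvgB (massl Z) _; apply: cvgB; first exact: cvg_cst.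
  exact: cvg_trans (cvg_app _ FG) cvg_harmonic.
rewrite -[sup S]subr0; apply: cvgr_to_ge cvg0 _.
by apply: nearW => n; have [_ /ltW] := fP n; rewrite -subr_ge0.
Qed.


(** * The bound on a finite type *)

Lemma lower_submeasure_le_sum (R : realType) (I : finType) (p : R)
    (phi : {set I} -> R) (A : {set I}) : lower_submeasure p phi ->
  phi A <= \sum_(i in A) phi [set i]%SET.
Proof.
move=> Hphi; elim: {A}#|A| {-2}A (erefl #|A|) => [|n IH] A.
  move=> /eqP; rewrite finset.cards_eq0 => /eqP ->.
  by rewrite big_set0 (lsm0 Hphi).
move=> An; have /card_gt0P[i iA] : (0 < #|A|)%N by rewrite An.
rewrite (big_setD1 i)//= -{1}(finset.setD1K iA).
rewrite (le_trans (lsm_sub Hphi _))//; last first.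
  by rewrite lerD2l IH//; move: An; rewrite (finset.cardsD1 i) iA => -[].
by apply/setP => j; rewrite !inE; case: eqP => // ->; rewrite eqxx.
Qed.

(** The conclusion is proved for all [Z] in place of the whole type: the proof
takes the set [Y] with the worst ratio of maximal mass to [phi] and finds a
contradiction inside [Y]. *)
Lemma finite_bound (R : realType) (I : finType) (p rho : R)
    (phi : {set I} -> R) : 1 <= p -> 2^-1 <= rho <= 1 ->
  2^-1 `^ p + rho `^ p = 1 -> lower_submeasure p phi ->
  exists2 w, dominated phi w &
    (1 - rho) * phi [set: I]%SET <= rho * mass w [set: I]%SET.
Proof.
move=> p1 rho_itv rhoE Hphi; have /andP[rho2 rho1] := rho_itv.
have p0 : 0 < p by rewrite (lt_le_trans _ p1).
have phi0 B : 0 <= phi B.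
  by rewrite -(lsm0 Hphi) (lsm_mono Hphi)// finset.sub0set.
have /choice[W WP] Z : exists w, dominated phi w /\
    forall v, dominated phi v -> mass v Z <= mass w Z.
  by have [w] := exists_optimal Z phi0; exists w.
pose kap Z := mass (W Z) Z.
have kap_max v Z : dominated phi v -> mass v Z <= kap Z.
  by have [_] := WP Z; apply.
have Wdom Z : dominated phi (W Z) by have [] := WP Z.
suff main Z : (1 - rho) * phi Z <= rho * kap Z by exists (W [set: I]%SET).
rewrite leNgt; apply/negP => bad.
have kap0 Y : 0 <= kap Y by apply: mass_ge0 => i; have [[]] := WP Y.
have phiZ : 0 < phi Z.
  rewrite lt0r phi0 andbT; apply/eqP => E; move: bad; rewrite E mulr0.
  by rewrite ltNge mulr_ge0//; lra.
case: (@Order.TotalTheory.arg_minP _ _ _ Z (fun Y => 0 < phi Y)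
  (fun Y => kap Y / phi Y) phiZ) => Y phiY Ymin.
set g := kap Y / phi Y in Ymin.
have kapE : kap Y = g * phi Y by rewrite divfK ?gt_eqF.
have rhog : rho * g < 1 - rho.
  have : kap Z / phi Z * rho < 1 - rho.
    by rewrite mulrAC ltr_pdivrMr// mulrC.
  by have := Ymin _ phiZ; rewrite -/g; nra.
(* Point masses are below [phi], so the maximal mass of [Y] is nonzero. *)
have g0 : 0 < g.
  rewrite divr_gt0// lt0r kap0 andbT; apply/eqP => E.
  have pt0 i : i \in Y -> phi [set i]%SET = 0.
    move=> iY; apply/eqP; rewrite eq_le phi0 andbT.
    pose v j := if j == i then phi [set i]%SET else 0.
    have vA A : mass v A = if i \in A then phi [set i]%SET else 0.
      rewrite /mass -big_mkcondr/=; case: ifP => iA.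
        rewrite (big_pred1 i) // => j /=.
        case: eqP => [->|//]; first by rewrite iA.
        by rewrite andbF.
      by rewrite big1 // => j /andP[jA /eqP ji]; rewrite ji iA in jA.
    rewrite -E; have -> : phi [set i]%SET = mass v Y by rewrite vA iY.
    apply: kap_max; split => [j|A]; first by rewrite /v; case: ifP.
    by rewrite vA; case: ifP => // iA; rewrite (lsm_mono Hphi)// finset.sub1set.
  suff : phi Y <= 0 by rewrite leNgt phiY.
  by rewrite (le_trans (lower_submeasure_le_sum Y Hphi))// big1.
(* The midpoint of the interval from [2 * rho] to [2 * (1 - rho) / g]. *)
pose c := rho + (1 - rho) / g.
have c2 : 2 * rho < c by rewrite /c mulr_natl mulr2n ltrD2l ltr_pdivlMr// mulrC.
have cg : c * g < 2 * (1 - rho) by rewrite /c mulrDl divfK ?gt_eqF//; lra.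
have c0 : 0 < c by lra.
have k0 : 0 < kap Y by rewrite kapE mulr_gt0.
set w := W Y; have [w0 wphi] : dominated phi w := Wdom Y.
pose P (B : {set I}) := (B \subset Y) && (phi B <= c * mass w B).
have P0 : P finset.set0 by rewrite /P finset.sub0set (lsm0 Hphi) mass0 mulr0 /=.
case: (arg_maxnP (fun B : {set I} => #|B|) P0) => B /andP[BY phiB] Bmax.
set Z' := Y :\: B.
have BZ : B :&: Z' = finset.set0.
  by rewrite finset.setIDA finset.setIC finset.setDIl finset.setDv finset.setI0.
have BZU : B :|: Z' = Y.
  by rewrite -[RHS](finset.setID Y B) (finset.setIidPr BY).
set y := mass w B / kap Y.
have wBE : mass w B = y * kap Y by rewrite divfK ?gt_eqF.
have wZE : mass w Z' = (1 - y) * kap Y by rewrite massD// wBE -/(kap Y); ring.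
have wB0 := mass_ge0 B w0; have wZ0 := mass_ge0 Z' w0.
have y0 : 0 <= y by rewrite divr_ge0.
have y1 : y <= 1 by move: wZ0; rewrite wZE pmulr_lge0// subr_ge0.
(* No measure has more mass on [Y] than [w], not even one glued from [w] on [B]
   and [v] on the rest. *)
have combine v : dominated phi v -> y `^ p + (mass v Z' / kap Y) `^ p <= 1.
  move=> vphi; have [nu nuphi] := dominated_mass_lower p1 Hphi (Wdom Y) vphi BZ.
  rewrite BZU -/w => h.
  have vZ0 : 0 <= mass v Z' by apply: mass_ge0; case: vphi.
  rewrite -(@ler_pM2r _ (kap Y `^ p)) ?powR_gt0// mulrDl mul1r.
  rewrite -!powRM ?divr_ge0// !divfK ?gt_eqF//.
  apply: le_trans h _; rewrite ge0_ler_powR ?nnegrE ?(ltW p0)//.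
    by apply: mass_ge0; case: nuphi.
  exact: kap_max.
(* While [y < 1/2], no subset of the rest is cheap, as [B] is maximal; then
   [c * w] is below [phi] on the rest and has too much mass there. *)
have [ylt|yge] := ltP y 2^-1.
  have cwphi (A : {set I}) : A \subset Z' -> c * mass w A <= phi A.
    move=> AZ; rewrite leNgt; apply/negP => lt.
    have AB : A :&: B = finset.set0.
      apply/eqP; rewrite -finset.subset0 -BZ (finset.setIC A).
      exact: finset.setIS.
    have AY : A \subset Y.
      by apply: fintype.subset_trans AZ (finset.subsetDl _ _).
    have PAB : P (A :|: B).
      rewrite /P finset.subUset AY BY massU// mulrDr.
      by rewrite (le_trans (lsm_sub Hphi AB))// lerD// ltW.
    have : (#|A :|: B| <= #|B|)%N by exact: Bmax.
    rewrite finset.cardsU AB finset.cards0 subn0 -[leqRHS]add0n leq_add2r.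
    rewrite leqn0 finset.cards_eq0 => /eqP A0.
    by move: lt; rewrite A0 mass0 (lsm0 Hphi) mulr0 ltxx.
  (* The empty first part gives [v] the shape of [mass_glue]. *)
  pose v i := if i \in finset.set0 then 0 * w i
              else if i \in Z' then c * w i else 0.
  have vE (A : {set I}) : mass v A = c * mass w (A :&: Z').
    by rewrite mass_glue ?finset.set0I// mul0r add0r.
  have vdom : dominated phi v.
    split=> [i|A].
      by rewrite /v !inE; case: ifP => // _; rewrite mulr_ge0// ltW.
    rewrite vE (le_trans (cwphi _ _))// ?finset.subsetIr//.
    by rewrite (lsm_mono Hphi)// finset.subsetIl.
  have := combine v vdom.
  rewrite vE finset.setIid wZE mulrA mulfK ?gt_eqF// => h.
  have := @powR_sum_ge1_left R p rho y p1 _ rhoE.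
  rewrite y0 (ltW ylt) => /(_ _ isT) h'.
  have lt : (2 * rho * (1 - y)) `^ p < (c * (1 - y)) `^ p.
    by apply: (gt0_ltr_powR p0); rewrite ?nnegrE ?ltr_pM2r//; nra.
  have := h' _; lra.
(* Now [y >= 1/2]: as [B] is cheap, [phi] is large on the rest, and by the
   choice of [Y] so is the maximal mass. *)
have := combine (W Z') (Wdom Z'); rewrite -/(kap Z') => h.
have phiZ' : phi Y - c * mass w B <= phi Z'.
  by rewrite lerBlDr -{1}BZU (le_trans (lsm_sub Hphi BZ))// addrC lerD2l.
have gphi : g * phi Z' <= kap Z'.
  have [->|n0] := eqVneq (phi Z') 0; first by rewrite mulr0.
  have pos : 0 < phi Z' by rewrite lt0r n0 phi0.
  by have := Ymin _ pos; rewrite ler_pdivlMr.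
have lek : 1 - c * g * y <= kap Z' / kap Y.
  rewrite ler_pdivlMr// (le_trans _ gphi)// kapE.
  apply: le_trans (_ : g * (phi Y - c * mass w B) <= _).
    by rewrite wBE kapE; lra.
  by rewrite ler_pM2l.
have h' := @powR_sum_ge1_right R p rho y p1 rho_itv rhoE; move: h'.
rewrite yge y1 => /(_ isT) h'.
have lt : (1 - 2 * (1 - rho) * y) `^ p < (kap Z' / kap Y) `^ p.
  apply: (gt0_ltr_powR p0); rewrite ?nnegrE ?divr_ge0//; first nra.
  apply: lt_le_trans lek; nra.
lra.
Qed.


(** * From finite algebras to arbitrary ones *)

Lemma algebra_exists_in (T : Type) (A : set (set T)) (J : eqType)
    (P : J -> set T) (r : seq J) : algebra_of_sets A -> (forall j, A (P j)) ->
  A [set t | exists2 j, j \in r & P j t].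
Proof.
move=> [A0 Acompl AU] AP; elim: r => [|j r IH].
  rewrite (_ : mkset _ = set0)//; apply/seteqP; split=> // t [j].
  by rewrite in_nil.
rewrite (_ : mkset _ = P j `|` [set t | exists2 j, j \in r & P j t]);
  last first.
  apply/seteqP; split=> [t [k]|t [Pj|[k kr Pk]]].
  - by rewrite inE => /orP[/eqP ->|kr] Pk; [left|right; exists k].
  - by exists j; rewrite ?mem_head.
  - by exists k; rewrite ?inE ?kr ?orbT.
exact: AU.
Qed.

Lemma algebra_forall (T : Type) (A : set (set T)) (J : finType)
    (P : J -> set T) : algebra_of_sets A -> (forall j, A (P j)) ->
  A [set t | forall j, P j t].
Proof.
move=> alg AP; have [A0 Acompl AU] := alg.
rewrite (_ : mkset _ = ~` [set t | exists2 j, j \in enum J & (~` P j) t]).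
  by apply: (Acompl); apply: algebra_exists_in => // j; exact: Acompl.
apply/seteqP; split=> [t Pt [j _]|t nPt j]; first exact.
by apply: contrapT => nP; apply: nPt; exists j; rewrite ?mem_enum.
Qed.

Lemma K_eq_ratio (R : realType) (p : R) : 1 < p ->
  exists rho, [/\ 2^-1 <= rho <= 1, 2^-1 `^ p + rho `^ p = 1 &
    K p = (1 - rho) / rho].
Proof.
move=> p1; have p0 : 0 < p by rewrite (lt_trans _ p1).
have pn0 : p != 0 by rewrite gt_eqF.
have t2 : 2 <= 2 `^ p :> R by rewrite le1r_powR ?ltW//; lra.
pose u : R := (2 `^ p - 1) `^ p^-1.
have u1 : 1 <= u.
  rewrite -(powRr0 (2 `^ p - 1)) /u ler_powR ?invr_ge0 ?(ltW p0)//; lra.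
have uE : u `^ p = 2 `^ p - 1 by rewrite /u -powRrM mulVf// powRr1//; lra.
have u2 : u <= 2.
  have -> : 2 = (2 `^ p) `^ p^-1 :> R by rewrite -powRrM mulfV// powRr1.
  by rewrite /u ge0_ler_powR ?nnegrE ?invr_ge0 ?(ltW p0)//; lra.
exists (u / 2); split; first lra.
  have h : 2^-1 `^ p * 2 `^ p = 1 :> R.
    by rewrite -powRM ?invr_ge0// mulVf ?powR1.
  rewrite powRM ?invr_ge0//; last lra.
  by rewrite uE; nra.
by rewrite /K -/u; field; rewrite gt_eqF//; lra.
Qed.

(** The list [s] sorts the points of [T] into cells, indexed by the vector of
their memberships. The finite case applied to [phi] on unions of cells gives a
weight on each cell, which is carried by a point mass chosen in the cell. Empty
cells have weight [0], since [phi set0 = 0]. Being a sum of point masses, [lam] is additive on all subsets of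
[T], so that additivity needs no reference to [s] in the limit. *)
Lemma discrete_measure_below (R : realType) (T : Type) (A : set (set T)) (p : R)
    (phi : set T -> R) (s : seq (set T)) :
  algebra_of_sets A -> 1 < p -> normalized phi -> submeasure A phi ->
  lower_estimate A p phi -> (forall X, X \in s -> A X) ->
  exists lam : set T -> R,
    [/\ forall X, 0 <= lam X <= lam setT,
        forall X Y, X `&` Y = set0 -> lam (X `|` Y) = lam X + lam Y,
        forall X, X \in s -> lam X <= phi X & K p <= lam setT].
Proof.
move=> alg p1 phi1 [[phi0 phi_mono] phi_sub] [_ [_ phi_low]] sA.
have [A0 Acompl AU] := alg.
have [t0] : exists t : T, True.
  apply: contrapT => noT; have : phi setT = 0.
    rewrite -phi0; congr phi; apply/seteqP; split=> // t _.
    by apply: noT; exists t.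
  by rewrite phi1 => /eqP; rewrite oner_eq0.
move=> _.
pose I := {ffun 'I_(size s) -> bool}.
pose code t : I := [ffun i : 'I_(size s) => `[< nth set0 s i t >]].
pose pre (S : {set I}) : set T := [set t | code t \in S].
have Acell v : A [set t | code t = v].
  rewrite (_ : mkset _ =
    [set t | forall i : 'I_(size s), `[< nth set0 s i t >] = v i]); last first.
    apply/seteqP; split=> t /=; first by move=> <- i; rewrite ffunE.
    by move=> h; apply/ffunP => i; rewrite ffunE h.
  apply: algebra_forall => // i.
  have Ai : A (nth set0 s i) by apply: sA; rewrite mem_nth.
  rewrite -[X in A X]/[set t | `[< nth set0 s i t >] = v i]; case: (v i).
    rewrite (_ : mkset _ = nth set0 s i)//; apply/seteqP; split=> t /=.
      by move=> /asboolP.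
    by move=> ?; apply/asboolP.
  rewrite (_ : mkset _ = ~` nth set0 s i); first exact: Acompl.
  apply/seteqP; split=> t /=; first by move=> /negbT /asboolPn.
  by move=> ?; apply/negbTE/asboolPn.
have Apre S : A (pre S).
  rewrite (_ : pre S = [set t | exists2 v, v \in enum S & code t = v]).
    exact: algebra_exists_in.
  apply/seteqP; split=> t; first by exists (code t); rewrite ?mem_enum.
  by move=> /= [v vS cv]; rewrite /pre/= cv -mem_enum.
have preU S S' : pre (S :|: S') = pre S `|` pre S'.
  apply/seteqP; split=> t; rewrite /pre/= inE; first by move=> /orP.
  by move=> [] ->; rewrite ?orbT.
have preI S S' : S :&: S' = finset.set0 -> pre S `&` pre S' = set0.
  move=> SS'; apply/seteqP; split=> // t [/= tS tS'].
  by have := finset.in_set0 (code t); rewrite -SS' inE tS tS'.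
have pre0 : pre finset.set0 = set0.
  by apply/seteqP; split=> // t; rewrite /pre/= inE.
have preT : pre [set: I]%SET = setT.
  by apply/seteqP; split=> // t; rewrite /pre/= inE.
have Hphi : lower_submeasure p (phi \o pre).
  split=> [|S S' SS'|S S' SS'|S S' SS'] /=; first by rewrite pre0.
  - by apply: phi_mono => // t /= /(fintype.subsetP SS').
  - by rewrite preU phi_sub// preI.
  - by rewrite preU phi_low// preI.
have [rho [rho_itv rhoE KE]] := K_eq_ratio p1.
have [w [w0 wphi] wK] := finite_bound (ltW p1) rho_itv rhoE Hphi.
have /choice[pt ptP] (v : I) : exists t, code t = v \/ w v = 0.
  have [[t tv]|nv] := pselect (exists t, code t = v); first by exists t; left.
  exists t0; right; apply/eqP; rewrite eq_le w0 andbT.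
  have := wphi [set v]%SET; rewrite /mass big_set1 /=.
  rewrite (_ : pre _ = set0) ?phi0//; apply/seteqP; split=> // t.
  by rewrite /pre/= inE => /eqP tv; apply: nv; exists t.
pose lam (X : set T) := \sum_v w v * (`[< X (pt v) >])%:R.
have lamT : lam setT = mass w [set: I]%SET.
  rewrite /lam /mass; under eq_bigr do rewrite asboolT// mulr1.
  by apply: eq_bigl => v; rewrite inE.
exists lam; split.
- move=> X; rewrite sumr_ge0 => [|v _]; last by rewrite mulr_ge0.
  rewrite ler_sum// => v _; rewrite (@asboolT (setT (pt v)))//.
  by rewrite ler_wpM2l// ler_nat leq_b1.
- move=> X Y XY; rewrite /lam -big_split/=; apply: eq_bigr => v _.
  rewrite -mulrDr -natrD; congr (_ * _%:R).
  have nXY : ~ (X (pt v) /\ Y (pt v)).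
    by move=> h; rewrite -[False]/(set0 (pt v)) -XY.
  by case: asboolP => XYv; case: asboolP => Xv; case: asboolP => Yv //=; tauto.
- move=> X Xs.
  have iX : (index X s < size s)%N by rewrite index_mem.
  apply: le_trans (_ : mass w [set v : I | v (Ordinal iX)]%SET <= _).
    rewrite /mass big_mkcond/=; apply: ler_sum => v _; rewrite inE.
    case: (ptP v) => [cv|->]; last by rewrite mul0r; case: ifP.
    rewrite (_ : v (Ordinal iX) = `[< X (pt v) >]).
      by case: asboolP => _; rewrite ?mulr1 ?mulr0.
    by rewrite -{1}cv ffunE /= nth_index.
  have := wphi [set v : I | v (Ordinal iX)]%SET => /= /le_trans; apply.
  apply: phi_mono => //; first exact: sA.
  by move=> t; rewrite /pre/= !inE ffunE /= nth_index// => /asboolP.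
- move: wK; rewrite -lamT /= preT phi1 mulr1 KE => wK.
  by rewrite ler_pdivrMr 1?mulrC//; lra.
Qed.


Theorem theorem2p1 (R : realType) (T : Type) (A : set (set T)) (p : R)
    (phi : set T -> R) :
  algebra_of_sets A ->
  1 < p ->
  normalized phi ->
  submeasure A phi ->
  lower_estimate A p phi ->
  exists lam : set T -> R,
    [/\ fa_measure A lam,
        (forall X : set T, A X -> 0 <= lam X <= phi X) &
        K p <= lam setT].
Proof.
move=> alg p1 phi1 phisub philow.
have [A0 Acompl AU] := alg.
have AT : A setT by rewrite -setC0; exact: Acompl.
pose inA (s : seq (set T)) := forall X, X \in s -> A X.
have /choice[f fP] s : exists lam : set T -> R, inA s ->
    [/\ forall X, 0 <= lam X <= lam setT,
        forall X Y, X `&` Y = set0 -> lam (X `|` Y) = lam X + lam Y,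
        forall X, X \in s -> lam X <= phi X & K p <= lam setT].
  have [sA|nsA] := pselect (inA s); last by exists (fun=> 0).
  have [lam] := discrete_measure_below alg p1 phi1 phisub philow sA.
  by exists lam.
(* The tail filter of the lists of members, ordered by inclusion. *)
pose F : set_system (seq (set T)) := [set P | exists2 s0, inA s0 &
  forall s, inA s -> {subset s0 <= s} -> P s].
have FF : ProperFilter F.
  split; last split.
  - by move=> [s0 s0A /(_ s0 s0A)]; apply.
  - by exists [::] => // X; rewrite in_nil.
  - move=> P Q [s1 s1A s1P] [s2 s2A s2Q]; exists (s1 ++ s2).
      by move=> X; rewrite mem_cat => /orP[/s1A|/s2A].
    move=> s sA s12; split; [apply: s1P|apply: s2Q] => // X Xs; apply: s12;
      by rewrite mem_cat Xs ?orbT.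
  - by move=> P Q PQ [s0 s0A s0P]; exists s0 => // s sA /(s0P _ sA)/PQ.
have F_inA : F inA by exists [::] => // X; rewrite in_nil.
have F_mem X : A X -> F [set s : seq (set T) | X \in s].
  move=> AX; exists [:: X] => [Y|s _]; first by rewrite inE => /eqP ->.
  by apply; rewrite mem_head.
have [|G [lam [GF FG lamP]]] :=
  @bounded_family_ultralimit R _ _ F f (fun=> 1) FF _.
  move=> X; apply: filterS2 F_inA (F_mem _ AT) => s sA Ts /=.
  have [bnd _ /(_ _ Ts) + _] := fP s sA; rewrite phi1 => le1.
  by have /andP[-> /le_trans] := bnd X; apply.
have GinA := FG _ F_inA.
have lam_ge0 X : 0 <= lam X.
  apply: cvgr_to_ge (lamP X) _; apply: filterS GinA => s sA.
  by have [bnd _ _ _] := fP s sA; have /andP[] := bnd X.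
have lamU X Y : X `&` Y = set0 -> lam (X `|` Y) = lam X + lam Y.
  move=> XY; apply: cvg_unique (lamP (X `|` Y)) _ => //.
  apply: cvg_trans (cvgD (lamP X) (lamP Y)); apply: near_eq_cvg.
  by apply: filterS GinA => s sA; have [_ /(_ _ _ XY) -> _ _] := fP s sA.
have lam0 : lam set0 = 0.
  have := lamU set0 set0 (setI0 _); rewrite setU0 => /eqP.
  by rewrite -subr_eq0 opprD addrA subrr add0r oppr_eq0 => /eqP.
have lam_mono : monotone_setfun A lam.
  split=> // X Y _ _ XY; rewrite -(setDUK XY) lamU ?lerDl//.
  exact: setDIK.
exists lam; split.
- by split; split=> // X Y _ _ XY; rewrite lamU.
- move=> X AX; rewrite lam_ge0/=; apply: cvgr_to_le (lamP X) _.
  apply: filterS2 GinA (FG _ (F_mem _ AX)) => s sA Xs.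
  by have [_ _ /(_ _ Xs) + _] := fP s sA.
- apply: cvgr_to_ge (lamP setT) _; apply: filterS GinA => s sA.
  by have [_ _ _] := fP s sA.
Qed.
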